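(* There is a universal constant $K>0$ with the following property. For every irrational $\alpha\in(0,1)$, every integer $m\ge1$, every $\gamma\in\mathbb{R}/\mathbb{Z}$ and every $N\in\mathbb{N}$, \[\bigl|\#\{n\in\mathbb{N}:n\le N,\ n\alpha\in\mathcal{J}(m,\gamma)\}-N|\mathcal{J}(m,\gamma)|\bigr|\le K,\] where $\mathcal{J}(m,\gamma)\subseteq\mathbb{R}/\mathbb{Z}$ is the special interval for $\alpha$ with parameters $m,\gamma$.
   Context: Here $\mathbb{N}=\{1,2,\ldots\}$, $n\alpha$ is regarded as an element of $\mathbb{R}/\mathbb{Z}$, and $|\cdot|$ applied to an interval in $\mathbb{R}/\mathbb{Z}$ denotes its length (total length of $\mathbb{R}/\mathbb{Z}$ being $1$). Special intervals. Let $\alpha\in(0,1)$ be irrational with simple continued fraction $\alpha=[0;a_1,a_2,\ldots]$ and let $q_k$ ($k\ge0$) be the denominators of its convergents in lowest terms ($q_0=1$, $q_1=a_1$, $q_{k+1}=a_{k+1}q_k+q_{k-1}$). Every non-negative integer $n$ has a unique Ostrowski expansion $n=\sum_{k=0}^\infty c_{k+1}q_k$ with integers $c_{k+1}$, only finitely many nonzero, such that $0\le c_1<a_1$, $0\le c_{k+1}\le a_{k+1}$ for $k\ge1$, and $c_k=0$ whenever $c_{k+1}=a_{k+1}$ for some $k\ge1$. For an integer $m\ge1$ let $\mathcal{A}(m)$ be the set of integers $n\ge0$ whose Ostrowski expansion has the form $n=\sum_{k=m}^\infty c_{k+1}q_k$ (so $0\in\mathcal{A}(m)$). For $\gamma\in\mathbb{R}/\mathbb{Z}$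 put $\mathcal{J}(m,\gamma)=\gamma+\overline{\{n\alpha:n\in\mathcal{A}(m)\}}\subseteq\mathbb{R}/\mathbb{Z}$ (closure in $\mathbb{R}/\mathbb{Z}$). The sets $\mathcal{J}(m,\gamma)$, which are intervals in $\mathbb{R}/\mathbb{Z}$, are the special intervals for $\alpha$. *)

(* Defs.v *)
From HB Require Import structures.
From mathcomp Require Import all_boot all_order all_algebra generic_quotient.
From mathcomp Require Import ring_quotient.
From mathcomp Require Import all_classical all_reals all_analysis.
Import Order.TTheory GRing.Theory Num.Theory.
Import numFieldNormedType.Exports.

Set Implicit Arguments.
Unset Strict Implicit.
Unset Printing Implicit Defensive.

Local Open Scope classical_set_scope.
Local Open Scope ring_scope.
Local Open Scope quotient_scope.

Section Circle.
Variable R : realType.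

(* Num.int_num_subdef is the predicate underlying Num.int. *)
Definition int_subgroup : zmodClosed R :=
  GRing.ZmodClosed.clone R (@Num.int_num_subdef R) _.

(* R/Z, with both its group structure and its quotient topology. *)
Definition circle : Type := quotient_topology {ideal_quot int_subgroup}.

HB.instance Definition _ := Topological.on circle.
HB.instance Definition _ := Quotient.on circle.
(* Built from the group laws of {ideal_quot int_subgroup} rather than copied:
   the copy would bring a second, non-convertible eqType structure. *)
HB.instance Definition _ := @GRing.isZmodule.Build circle _ _ _
  (@Quotient.addqA _ int_subgroup) (@Quotient.addqC _ int_subgroup)
  (@Quotient.add0q _ int_subgroup) (@Quotient.addNq _ int_subgroup).

Definition to_circle (x : R) : circle := \pi_circle x.

Lemma to_circle_is_zmod_morphism : zmod_morphism to_circle.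
Proof.
move=> x y; rewrite /to_circle.
rewrite [LHS](@Quotient.pi_add _ int_subgroup x (- y)).
by congr (_ + _); exact: (@Quotient.pi_opp _ int_subgroup).
Qed.

HB.instance Definition _ :=
  GRing.isZmodMorphism.Build R circle to_circle to_circle_is_zmod_morphism.

Lemma eq_to_circle (x y : R) :
  to_circle x = to_circle y <-> x - y \is a Num.int.
Proof.
have := @Quotient.idealrBE R int_subgroup x y.
case: eqP => [h E|h E]; split => H.
- exact: E.
- exact: h.
- by case: h.
- by exfalso; exact: (elimF idP E H).
Qed.

(* Lebesgue measure of total mass 1 on R/Z, computed on the fundamental domain
   [0, 1[; on an interval of R/Z this is its length. *)
Definition circle_length (A : set circle) : R :=
  fine (lebesgue_measure (`[0, 1[ `&` to_circle @^-1` A)).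

End Circle.

Section ContinuedFraction.
Variables (R : realType) (alpha : R).

(* Complete remainders [0; a_(k+1), a_(k+2), ...] : iterates of the Gauss map
   on alpha. *)
Definition cf_rem (k : nat) : R :=
  iter k (fun x => x^-1 - (Num.truncn x^-1)%:R) alpha.

(* The partial quotient a_k for k >= 1; the value at k = 0 is never used. *)
Definition cf_quot (k : nat) : nat := Num.truncn (cf_rem k.-1)^-1.

Fixpoint cf_denom (k : nat) : nat :=
  match k with
  | 0 => 1
  | k1.+1 =>
      match k1 with
      | 0 => cf_quot 1
      | k2.+1 => cf_quot k * cf_denom k1 + cf_denom k2
      end
  end%N.

(* c is the Ostrowski digit sequence of n, where c k.+1 is the digit attached
   to q_k and c 0 is irrelevant. *)
Definition ostrowski (n : nat) (c : nat -> nat) : Prop :=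
  [/\ (c 1 < cf_quot 1)%N,
      forall k, (1 <= k)%N -> (c k.+1 <= cf_quot k.+1)%N,
      forall k, (1 <= k)%N -> c k.+1 = cf_quot k.+1 -> c k = 0%N
    & exists2 L, (forall k, (L <= k)%N -> c k.+1 = 0%N)
               & n = (\sum_(0 <= k < L) c k.+1 * cf_denom k)%N].

Definition ostrowski_from (m : nat) : set nat :=
  [set n | exists2 c, ostrowski n c & forall k, (k < m)%N -> c k.+1 = 0%N].

Definition special_interval (m : nat) (gamma : circle R) : set (circle R) :=
  [set gamma + x | x in
     closure [set to_circle (n%:R * alpha) | n in ostrowski_from m]].

End ContinuedFraction.

(* Main.v *)
(* A special interval is the image in R/Z of a closed interval of length
   d_m + d_(m-1), where d_k = |q_k alpha - p_k|: the bound on the digits keeps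
   the sums sum_(k >= m) c_(k+1) (q_k alpha - p_k) inside that interval, and a
   greedy choice of digits shows that they are dense in it.  Cut it into two
   arcs of lengths d_m and d_(m-1).  The indicator of a half-open arc of length
   d_k is a difference of floors, and since d_k = +-q_k alpha modulo 1 it is a
   coboundary up to a constant: its Birkhoff sums telescope to differences of
   two sums of q_k consecutive terms floor(y + i alpha).  As alpha is within
   1/q_k^2 of p_k/q_k and i -> i p_k permutes the residues modulo q_k, such a
   sum equals q_k y + c + O(1) with c independent of y.  Closing the arc costs
   at most one more point because alpha is irrational. *)
Require Import Defs.
From mathcomp Require Import all_boot all_order all_algebra.
From mathcomp Require Import all_classical all_reals all_analysis.
From mathcomp Require Import zify ring lra.
Import Order.TTheory GRing.Theory Num.Theory.
Import numFieldNormedType.Exports.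

Set Implicit Arguments.
Unset Strict Implicit.
Unset Printing Implicit Defensive.

Local Open Scope classical_set_scope.
Local Open Scope ring_scope.

(** * Sums of floors along a rotation *)

Lemma sum_shift_sub (V : zmodType) (f : nat -> V) (q N : nat) :
  \sum_(0 <= n < N) (f (n + q)%N - f n) = \sum_(0 <= i < q) (f (i + N)%N - f i).
Proof.
elim: N => [|N IHN].
  by rewrite big_nil big1// => i _; rewrite addn0 subrr.
rewrite big_nat_recr//= IHN addnC.
have -> : f (q + N)%N - f N = \sum_(0 <= i < q) (f (i.+1 + N)%N - f (i + N)%N).
  by rewrite (@telescope_sumr _ 0 q (fun i => f (i + N)%N)).
rewrite -big_split/=; apply: eq_bigr => i _.
by rewrite addrC addrA subrK addSnnS.
Qed.

(** [p] is invertible modulo [q], so [i -> t + p i] permutes the residues. *)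
Lemma sum_affine_modz (q : nat) (p t : int) : (0 < q)%N -> coprimez p q ->
  \sum_(i < q) ((t + p * i%:Z) %% q)%Z = \sum_(i < q) (i : nat)%:Z.
Proof.
move=> q0 pq.
have q0' : (q%:Z != 0) by lia.
have hlt (i : 'I_q) : (absz ((t + p * i%:Z) %% q)%Z < q)%N.
  have := ltz_pmod (t + p * i%:Z) (_ : 0 < q%:Z); have := modz_ge0 (t + p * i%:Z) q0'; lia.
pose h (i : 'I_q) := Ordinal (hlt i).
have hinj : injective h.
  move=> i j /(congr1 val)/= ij.
  have /eqP : ((t + p * i%:Z) %% q)%Z = ((t + p * j%:Z) %% q)%Z.
    by have := modz_ge0 (t + p * i%:Z) q0'; have := modz_ge0 (t + p * j%:Z) q0'; lia.
  rewrite eqz_mod_dvd opprD addrACA subrr add0r -mulrBr Gauss_dvdzr; last first.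
    by rewrite coprimez_sym.
  rewrite -eqz_mod_dvd => /eqP; rewrite !modz_small ?ltz_nat ?ltn_ord//.
  by move=> [] /ord_inj.
rewrite [RHS](reindex_inj hinj)/=; apply: eq_bigr => i _.
by rewrite gez0_abs// modz_ge0.
Qed.

Section FloorSums.
Variable R : realType.
Implicit Types (alpha w x y z : R) (p : int) (q N : nat).

Lemma floor_div_nat z (q : nat) : (0 < q)%N ->
  Num.floor (z / q%:R) = (Num.floor z %/ q)%Z.
Proof.
move=> q0; 
have q0R : 0 < q%:R :> R by rewrite ltr0n.
apply/eqP; rewrite eq_le; apply/andP; split.
  rewrite lez_divRL// floor_ge_int intrM -ler_pdivlMr//.
  by rewrite -floor_ge_int.
rewrite floor_ge_int ler_pdivlMr// -[q%:R]/((q%:Z)%:~R) -intrM -floor_ge_int.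
by rewrite -lez_divRL.
Qed.

(** Each floor is the quotient of [Num.floor x + p i] by [q]. Multiplied by [q] it is the dividend
    minus its remainder, and the remainders run over all residues. *)
Lemma sum_floor_affine p q x : (0 < q)%N -> coprimez p q ->
  (\sum_(i < q) Num.floor ((x + (p * i%:Z)%:~R) / q%:R)) * q%:Z
  = Num.floor x * q%:Z + (p - 1) * \sum_(i < q) (i : nat)%:Z.
Proof.
move=> q0 pq; rewrite mulr_suml.
transitivity (\sum_(i < q) ((Num.floor x + p * i%:Z) -
    ((Num.floor x + p * i%:Z) %% q)%Z)).
  apply: eq_bigr => i _; rewrite floor_div_nat// floorDrz ?intr_int// intrKfloor.
  by rewrite {2}(divz_eq (Num.floor x + p * i%:Z) q) addrK.
rewrite sumrB sum_affine_modz// big_split/= sumr_const card_ord -mulr_sumr.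
by rewrite -mulr_natr; ring.
Qed.

(** For [i < q], replacing [i alpha] by [i p / q] moves [q (z + i alpha)] by at most 1, and the
    rational sums are exact. The lower bound loses a further 1 to the floor of [q z - 1]. *)
Lemma sum_floor_bound alpha p q : (0 < q)%N -> coprimez p q ->
  `|q%:R * alpha - p%:~R| * q%:R <= 1 ->
  exists c : R, forall z,
    q%:R * z + c - 2 <= (\sum_(i < q) Num.floor (z + i%:R * alpha))%:~R
      <= q%:R * z + c + 1.
Proof.
move=> q0 pq pqa.
have q0R : 0 < q%:R :> R by rewrite ltr0n.
exists (((p - 1) * \sum_(i < q) (i : nat)%:Z)%:~R / q%:R) => z.
set c := _ / _.
have E x : (\sum_(i < q) Num.floor ((x + (p * i%:Z)%:~R) / q%:R))%:~R
    = (Num.floor x)%:~R + c.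
  apply: (mulIf (lt0r_neq0 q0R)); rewrite mulrDl divfK ?gt_eqF//.
  by rewrite -[q%:R]/((q%:Z)%:~R) -!intrM sum_floor_affine// intrD.
have dist (i : 'I_q) : `|q%:R * (i%:R * alpha) - (p * i%:Z)%:~R| <= 1.
  rewrite (_ : _ - _ = (q%:R * alpha - p%:~R) * i%:R); last first.
    by rewrite intrM/= -[i%:~R]/(i%:R); ring.
  rewrite normrM (ger0_norm (ler0n _ _)); apply: le_trans pqa.
  by apply: ler_wpM2l => //; rewrite ler_nat ltnW.
apply/andP; split.
  apply: (@le_trans _ _ ((Num.floor (q%:R * z - 1))%:~R + c)).
    have := floorD1_gt (q%:R * z - 1); rewrite intrD; lra.
  rewrite -E ler_int; apply: ler_sum => i _; apply: le_floor.
  rewrite ler_pdivrMr//.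
  by have := dist i; rewrite ler_norml => /andP[]; lra.
apply: (@le_trans _ _ ((Num.floor (q%:R * z + 1))%:~R + c)); last first.
  have := floor_le (q%:R * z + 1); lra.
rewrite -E ler_int; apply: ler_sum => i _; apply: le_floor.
rewrite ler_pdivlMr//.
by have := dist i; rewrite ler_norml => /andP[]; lra.
Qed.

Lemma sum_floor_increment alpha p q y N : (0 < q)%N -> coprimez p q ->
  `|q%:R * alpha - p%:~R| * q%:R <= 1 ->
  `|(\sum_(0 <= n < N) (Num.floor (y + (n + q)%:R * alpha) -
                        Num.floor (y + n%:R * alpha)))%:~R
    - N%:R * (q%:R * alpha)| <= 3.
Proof.
move=> q0 pq pqa; have [c cE] := sum_floor_bound q0 pq pqa.
(* Only [q] terms remain at each end, starting from [y + N alpha] and from [y]. The constant [c]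
   cancels, and 3 is the width of the window from [-2] to [1]. *)
rewrite (sum_shift_sub (fun n => Num.floor (y + n%:R * alpha))).
rewrite sumrB !big_mkord.
rewrite (eq_bigr (fun i : 'I_q => Num.floor (y + N%:R * alpha + i%:R * alpha)));
  last by move=> i _; rewrite natrD; congr Num.floor; ring.
have := cE (y + N%:R * alpha); have := cE y.
rewrite intrB ler_norml => /andP[h1 h2] /andP[h3 h4].
apply/andP; split; lra.
Qed.
End FloorSums.

(** * Continued fractions and convergents *)

Section Convergents.
Variables (R : realType) (alpha : R).
Hypotheses (alpha01 : 0 < alpha < 1) (alpha_irr : irrational alpha).

Local Notation t := (cf_rem alpha).
Local Notation a := (cf_quot alpha).
Local Notation q := (cf_denom alpha).

Fixpoint cf_num (k : nat) : int :=
  match k with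
  | 0 => 0
  | k1.+1 =>
      match k1 with
      | 0 => 1
      | k2.+1 => (a k)%:Z * cf_num k1 + cf_num k2
      end
  end.

(* [cf_dist k.+1 = |q_k alpha - p_k|], and [cf_dist 0 = 1] is the same quantity
   for the conventional convergent [1/0] of index [-1]. *)
Definition cf_dist (k : nat) : R := \prod_(i < k) t i.

Local Notation p := cf_num.
Local Notation D := cf_dist.

(** A rational image under the Gauss map would have a rational source. Irrationality excludes the
    remainder 0, so the expansion never stops. *)
Lemma cf_remP k : irrational (t k) /\ 0 < t k < 1.
Proof.
elim: k => [//|k [irr /andP[t0 t1]]].
have irr' : ~ rational (t k.+1).
  move=> [r _ rE]; apply: (irr : ~ rational _).
  exists ((r + (Num.truncn (t k)^-1)%:R)^-1) => //.
  rewrite fmorphV/= rmorphD/= rmorph_nat rE.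
  by rewrite -[t k.+1]/((t k)^-1 - (Num.truncn (t k)^-1)%:R) subrK invrK.
split=> //; have t1V : 0 <= (t k)^-1 by rewrite invr_ge0 ltW.
have /andP[h1 h2] := truncn_itv t1V.
rewrite -natr1 in h2; rewrite lt_neqAle eq_sym.
apply/andP; split; last by rewrite -[t k.+1]/((t k)^-1 - _); lra.
rewrite -[X in _ && (_ <= X)]/((t k)^-1 - _) subr_ge0 h1 andbT.
by apply/eqP => h; apply: irr'; exists 0 => //; rewrite rmorph0 h.
Qed.

Lemma cf_rem_gt0 k : 0 < t k.
Proof. by have [_ /andP[]] := cf_remP k. Qed.

Lemma cf_quot_gt0 k : (0 < a k.+1)%N.
Proof.
rewrite truncn_gt0/= -[1]invr1 lef_pV2 ?posrE ?cf_rem_gt0//.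
by have [_ /andP[_ /ltW]] := cf_remP k.
Qed.

Lemma cf_dist_gt0 k : 0 < D k.
Proof. by apply: prodr_gt0 => i _; exact: cf_rem_gt0. Qed.

Lemma cf_dist0 : D 0 = 1.
Proof. exact: big_ord0. Qed.

Lemma cf_dist1 : D 1 = alpha.
Proof. exact: big_ord1. Qed.

(** This is [1 / t k = a k.+1 + t k.+1] multiplied by [D k.+1]. *)
Lemma cf_dist_rec k : D k = (a k.+1)%:R * D k.+1 + D k.+2.
Proof.
have DS j : D j.+1 = D j * t j by exact: big_ord_recr.
rewrite !DS -[t k.+1]/((t k)^-1 - (a k.+1)%:R).
by field; rewrite gt_eqF ?cf_rem_gt0.
Qed.

Lemma cf_dist_le k : D k.+1 + D k.+2 <= D k.
Proof.
rewrite (cf_dist_rec k) lerD2r ler_peMl ?(ltW (cf_dist_gt0 _))//.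
by rewrite ler1n cf_quot_gt0.
Qed.

Lemma cf_denom_dist k : (q k)%:R * alpha - (p k)%:~R = (-1) ^+ k * D k.+1.
Proof.
suff: (q k)%:R * alpha - (p k)%:~R = (-1) ^+ k * D k.+1
  /\ (q k.+1)%:R * alpha - (p k.+1)%:~R = (-1) ^+ k.+1 * D k.+2 by case.
elim: k => [|k [IH1 IH2]]; split => //.
- by rewrite expr0 !mul1r subr0 cf_dist1.
- have := cf_dist_rec 0; rewrite cf_dist0 cf_dist1 expr1/=; lra.
- have -> : D k.+3 = D k.+1 - (a k.+2)%:R * D k.+2 by have := cf_dist_rec k.+1; lra.
  rewrite [q k.+2]/= -/q [p k.+2]/= -/p natrD natrM intrD intrM -pmulrn.
  have -> : (-1) ^+ k.+2 * (D k.+1 - (a k.+2)%:R * D k.+2)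
    = (-1) ^+ k * D k.+1 + (a k.+2)%:R * ((-1) ^+ k.+1 * D k.+2) by rewrite !exprS; ring.
  by rewrite -IH1 -IH2; ring.
Qed.

Lemma cf_denom_gt0 k : (0 < q k)%N.
Proof.
suff: (0 < q k)%N && (0 < q k.+1)%N by case/andP.
elim: k => [|k /andP[h1 h2]]; first by rewrite /= cf_quot_gt0.
by rewrite h2/= addn_gt0 h1 orbT.
Qed.

Lemma cf_denom_rec k : q k.+2 = (a k.+2 * q k.+1 + q k)%N.
Proof. by []. Qed.

Lemma cf_denom_mono k : (q k <= q k.+1)%N.
Proof.
case: k => [|k]; first exact: cf_quot_gt0.
by rewrite cf_denom_rec -[leqLHS]addn0 leq_add// leq_pmull// cf_quot_gt0.
Qed.

Lemma cf_denom_ge k : (k <= q k)%N.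
Proof.
elim: k => // -[_|k IH]; first exact: cf_quot_gt0.
by rewrite cf_denom_rec; have := cf_quot_gt0 k.+1; have := cf_denom_gt0 k; nia.
Qed.

(** The recurrences of [q] and [D] leave this expression invariant. It is the source of the quality
    of approximation and of [D k -> 0]. *)
Lemma cf_denom_dist_sum k : (q k.+1)%:R * D k.+1 + (q k)%:R * D k.+2 = 1.
Proof.
elim: k => [|k IH].
  by rewrite -[RHS]cf_dist0 [RHS]cf_dist_rec/= mul1r.
rewrite -{}[RHS]IH cf_denom_rec natrD natrM (cf_dist_rec k.+1); ring.
Qed.

Lemma cf_denomS_dist_le k : (q k.+1)%:R * D k.+1 <= 1.
Proof.
by rewrite -[leRHS](cf_denom_dist_sum k) lerDl mulr_ge0 ?ler0n// ltW ?cf_dist_gt0.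
Qed.

Lemma cf_denom_approx k :
  `|(q k)%:R * alpha - (p k)%:~R| * (q k)%:R <= 1.
Proof.
rewrite cf_denom_dist normrM normrX normrN1 expr1n mul1r gtr0_norm ?cf_dist_gt0//.
rewrite mulrC; apply: le_trans (cf_denomS_dist_le k).
by rewrite ler_wpM2r ?ler_nat ?cf_denom_mono// ltW ?cf_dist_gt0.
Qed.

Lemma cf_dist_small (e : R) : 0 < e -> exists L, forall k, (L <= k)%N -> D k < e.
Proof.
move=> e0; exists (Num.truncn e^-1).+1 => -[//|k] Lk.
rewrite -(invrK e) -[_^-1 as X in _ < X]div1r ltr_pdivlMr ?invr_gt0//.
apply: lt_le_trans (cf_denomS_dist_le k).
rewrite mulrC ltr_pM2r ?cf_dist_gt0//.
apply: lt_le_trans (truncnS_gt e^-1) _.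
by rewrite ler_nat (leq_trans Lk)// cf_denom_ge.
Qed.

Lemma cf_coprime k : coprimez (p k) (q k).
Proof.
have det j : p j.+1 * (q j)%:Z - p j * (q j.+1)%:Z = (-1) ^+ j.
  elim: j => [|j IH]; first by rewrite /= mulr1 mul0r subr0.
  rewrite exprS -IH cf_denom_rec [p j.+2]/= -/p PoszD PoszM; ring.
(* The determinant [det] supplies Bezout coefficients, up to the sign [(-1) ^+ k]. *)
apply/coprimezP; exists ((-1) ^+ k.+1 * (q k.+1)%:Z, (-1) ^+ k * p k.+1) => /=.
transitivity ((-1) ^+ k * (p k.+1 * (q k)%:Z - p k * (q k.+1)%:Z)).
  by rewrite exprS; ring.
by rewrite det -exprD -signr_odd oddD addbb.
Qed.

End Convergents.

(** * Arcs of the circle *)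

Section Arcs.
Variable R : realType.
Implicit Types (u s g x : R).

Definition circle_arc u s : set (circle R) :=
  @to_circle R @` [set x | u <= x <= u + s].

(** The least representative of [to_circle x] not below [u] is [u] plus the fractional part of
    [x - u]; it lies in the arc as soon as any representative does. *)
Lemma circle_arcP u s x : circle_arc u s (to_circle x) <-> x - u - (Num.floor (x - u))%:~R <= s.
Proof.
split=> [[y /= /andP[uy ys]]|h].
  move/eq_to_circle/intrP => [l lE].
  have : - l <= Num.floor (x - u) by rewrite floor_ge_int intrN; lra.
  rewrite -(ler_int R) intrN; lra.
exists (x - (Num.floor (x - u))%:~R) => /=.
  have := floor_le (x - u); lra.
apply/eq_to_circle/intrP; exists (- Num.floor (x - u)); rewrite intrN; lra.
Qed.

Lemma to_circle_surj (y : circle R) : exists x, y = to_circle x.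
Proof. by exists (repr y); rewrite /to_circle reprK. Qed.

Lemma to_circle_continuous : continuous (@to_circle R).
Proof. exact: pi_continuous. Qed.

Lemma closed_arc u s : 0 <= s -> closed (circle_arc u s).
Proof.
move=> s0; rewrite -openC.
suff: open (@to_circle R @^-1` (~` circle_arc u s)) by [].
rewrite openE => x /= nx; apply/nbhs_ballP.
have {}nx : s < x - u - (Num.floor (x - u))%:~R.
  by rewrite ltNge; apply/negP => h; apply: nx; exact/circle_arcP.
have x1 := floorD1_gt (x - u); rewrite intrD in x1.
(* The fractional part of [x - u] lies strictly between [s] and 1. This radius keeps it there, so
   the floor does not jump. *)
exists (Num.min (x - u - (Num.floor (x - u))%:~R - s)
                ((Num.floor (x - u))%:~R + 1 - (x - u))) => /=.
  by rewrite lt_min; apply/andP; split; lra.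
move=> y; rewrite /ball/= lt_min !ltr_norml => /andP[/andP[h1 h2] /andP[h3 h4]].
move/circle_arcP; have -> : Num.floor (y - u) = Num.floor (x - u).
  by apply: floor_def; rewrite intrD; lra.
lra.
Qed.

Lemma circle_length_arc u s : 0 <= s <= 1 -> circle_length (circle_arc u s) = s.
Proof.
move=> /andP[s0 s1].
wlog u01 : u / 0 <= u < 1.
  move=> wl; rewrite -[RHS](wl (u - (Num.floor u)%:~R)); last first.
    have := floor_le u; have := floorD1_gt u; rewrite intrD; lra.
  congr circle_length; apply/seteqP; split=> y; have [x ->] := to_circle_surj y;
  rewrite !circle_arcP opprB addrA (addrAC x) (floorDrz _ (intr_int _ _)) intrKfloor intrD; lra.
rewrite /circle_length.
have mem x : 0 <= x < 1 -> circle_arc u s (to_circle x) <->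
    (u <= x <= u + s) || (x < u) && (x <= u + s - 1).
  move=> x01; rewrite circle_arcP; have [xu|xu] := ltP x u.
    have -> : Num.floor (x - u) = -1 by apply: floor_def; rewrite intrD intrN; lra.
    rewrite intrN andFb/=; split; lra.
  have -> : Num.floor (x - u) = 0 by apply: floor_def; rewrite intrD; lra.
  rewrite andTb/= orbF; split; lra.
have [us|us] := ltP (u + s) 1.
  have -> : `[0, 1[ `&` @to_circle R @^-1` circle_arc u s = [set` `[u, u + s]].
    apply/seteqP; split=> x /=; rewrite !in_itv/=.
      move=> [x01 /(mem _ x01)]; lra.
    move=> xu; have x01 : 0 <= x < 1 by lra.
    by split=> //; apply/mem => //; rewrite xu.
  rewrite lebesgue_measure_itv/= lte_fin; case: ltP => h; rewrite ?EFinN -?EFinB/=; lra.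
(* For [s = 1] the pieces [[0, u + s - 1]] and [[u, 1[] would share [u], so the disjoint union below
   needs [s < 1]. *)
have [s1'|s1'] := eqVneq s 1.
  have -> : `[0, 1[ `&` @to_circle R @^-1` circle_arc u s = [set` `[0, 1[].
    apply/seteqP; split=> x /=; rewrite !in_itv/=; first by case.
    by move=> x01; split=> //; apply/mem => //; lra.
  by rewrite lebesgue_measure_itv/= lte_fin ltr01 s1' /= subr0.
have {}s1 : s < 1 by rewrite lt_neqAle s1'.
have -> : `[0, 1[ `&` @to_circle R @^-1` circle_arc u s
    = [set` `[0, u + s - 1]] `|` [set` `[u, 1[].
  apply/seteqP; split=> x /=; rewrite !in_itv/=.
    move=> [x01 /(mem _ x01)] h.
    by case: (ltP x u) => xu; [left|right]; lra.
  move=> h; have x01 : 0 <= x < 1 by case: h; lra.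
  by split=> //; apply/mem => //; case: h; lra.
rewrite measureU//; last first.
  by apply/seteqP; split=> x //=; rewrite !in_itv/=; lra.
rewrite /= !lebesgue_measure_itv/= !lte_fin.
by case: ltP => h; case: ltP => h'; rewrite /=; lra.
Qed.

Lemma add_arc g u s : [set to_circle g + x | x in circle_arc u s] = circle_arc (g + u) s.
Proof.
apply/seteqP; split=> [_ [_ [x /= ux <-] <-]|_ [x /= ux <-]].
  by exists (g + x); rewrite /= ?raddfD//; lra.
exists (to_circle (x - g)); last by rewrite -raddfD addrC subrK.
by exists (x - g) => //=; lra.
Qed.

(* The floors count integer points, so this is the indicator of a half-open
   circle_arc. *)
Lemma floor_sub_indicator u s x : 0 <= s <= 1 ->
  Num.floor (x - u) - Num.floor (x - u - s)
  = (x - u - (Num.floor (x - u))%:~R < s)%R%:Z.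
Proof.
move=> s01; have := floor_le (x - u); have := floorD1_gt (x - u).
rewrite intrD => h1 h2; case: ltP => h.
  have -> : Num.floor (x - u - s) = Num.floor (x - u) - 1; last lia.
  by apply: floor_def; rewrite !intrD intrN; lra.
have -> : Num.floor (x - u - s) = Num.floor (x - u); last lia.
by apply: floor_def; rewrite intrD; lra.
Qed.

End Arcs.

(** * Special intervals as arcs *)

Section Ostrowski.
Variables (R : realType) (alpha : R).
Hypotheses (alpha01 : 0 < alpha < 1) (alpha_irr : irrational alpha).

Local Notation a := (cf_quot alpha).
Local Notation q := (cf_denom alpha).
Local Notation p := (cf_num alpha).
Local Notation D := (cf_dist alpha).
Implicit Types (c : nat -> nat) (m j k L n : nat) (x : R).

(* [(-1)^m] times the representative close to [0] of [n alpha] modulo [1], for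
   the integer [n] with digits [c m.+1, ..., c (m + j)]. *)
Fixpoint ostrowski_value c m j : R :=
  if j is j'.+1 then (c m.+1)%:R * D m.+1 - ostrowski_value c m.+1 j' else 0.

Lemma eq_ostrowski_value c c' m j : (forall k, (m <= k)%N -> c k.+1 = c' k.+1) ->
  ostrowski_value c m j = ostrowski_value c' m j.
Proof.
elim: j m => //= j IH m cc; rewrite cc// (IH m.+1)// => k mk.
by apply: cc; exact: ltnW.
Qed.

Lemma ostrowski_valueE c m j :
  (\sum_(m <= k < m + j) c k.+1 * q k)%N%:R * alpha
    - (\sum_(m <= k < m + j) (c k.+1)%:Z * p k)%:~R
  = (-1) ^+ m * ostrowski_value c m j.
Proof.
elim: j m => [|j IH] m /=.
  by rewrite addn0 !big_geq// mul0r subrr mulr0.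
rewrite !(big_ltn (_ : m < m + j.+1)%N) ?addnS ?ltnS ?leq_addr// -addSn.
rewrite natrD intrD natrM intrM mulrBr mulrCA -cf_denom_dist//.
have := IH m.+1; rewrite exprS mulN1r mulNr => <-.
by rewrite -pmulrn; ring.
Qed.

(** The first term lies in [[0, a m.+1 * D m.+1]] and the subtracted tail in [[- D m.+2, D m.+1]];
    [cf_dist_rec] closes the induction. *)
Lemma ostrowski_value_bounds c m j : (forall k, (m <= k)%N -> (c k.+1 <= a k.+1)%N) ->
  - D m.+1 <= ostrowski_value c m j <= D m.
Proof.
elim: j m => [|j IH] m ca /=.
  by rewrite oppr_le0 !ltW ?cf_dist_gt0.
have /andP[] := IH m.+1 (fun k mk => ca k (ltnW mk)).
have : (c m.+1)%:R * D m.+1 <= (a m.+1)%:R * D m.+1.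
  by rewrite ler_pM2r ?cf_dist_gt0// ler_nat ca.
have : 0 <= (c m.+1)%:R * D m.+1 by rewrite mulr_ge0// ltW// cf_dist_gt0.
have := cf_dist_rec alpha01 alpha_irr m; lra.
Qed.

(* The second conjunct of the conclusion, on the first digit, is what makes the
   rule [c k.+1 = a k.+1 -> c k = 0] hold when one more digit is prepended. *)
Lemma ostrowski_greedy j m x : - D m.+1 <= x <= D m ->
  exists c, [/\ forall k, (m <= k)%N -> (c k.+1 <= a k.+1)%N,
    (x <= D m - D m.+1 -> (c m.+1 < a m.+1)%N),
    forall k, (m < k)%N -> c k.+1 = a k.+1 -> c k = 0%N,
    forall k, (k < m)%N || (m + j <= k)%N -> c k.+1 = 0%N
    & `|x - ostrowski_value c m j| <= D (m + j) + D (m + j).+1].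
Proof.
have D0 := cf_dist_gt0 alpha01 alpha_irr.
have a0 := cf_quot_gt0 alpha01 alpha_irr.
elim: j m x => [|j IH] m x /andP[x1 x2].
  exists (fun=> 0%N); split=> //=.
  rewrite subr0 addn0 ler_norml; have := D0 m; have := D0 m.+1; lra.
have Dm := cf_dist_rec alpha01 alpha_irr m.
(* The digit is the least [e] for which [e D_(m+1) - x] is not below the range of the tail. *)
have : exists e, x <= D m.+2 + e%:R * D m.+1 by exists (a m.+1); lra.
case/ex_minnP => e xe emin.
have ea : (e <= a m.+1)%N by apply: emin; lra.
have ea' : x <= D m - D m.+1 -> (e < a m.+1)%N.
  move=> xm; have /emin : x <= D m.+2 + (a m.+1).-1%:R * D m.+1.
    by have := a0 m; case: (a m.+1) Dm => // b + _; rewrite -natr1/=; lra.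
  by have := a0 m; lia.
(* Minimality of a positive [e] gains the extra [D m.+2], which forces the next digit below its
   maximum, as the Ostrowski rule demands. *)
have ypos : e%:R * D m.+1 - x <= D m.+1 - (0 < e)%N%:R * D m.+2.
  case: e emin {xe ea ea'} => [|e] emin; first by rewrite !mul0r; lra.
  have : ~~ (x <= D m.+2 + e%:R * D m.+1).
    by apply/negP => /emin; rewrite ltnn.
  by rewrite -ltNge -natr1 mul1r; lra.
have y1 : - D m.+2 <= e%:R * D m.+1 - x by lra.
have y2 : e%:R * D m.+1 - x <= D m.+1.
  by have := mulr_ge0 (ler0n R (0 < e)%N) (ltW (D0 m.+2)); lra.
have := IH m.+1 (e%:R * D m.+1 - x); rewrite y1 y2 => /(_ isT).
move=> [c [ca cm cz c0 cx]].
exists (fun k => if k == m.+1 then e else c k); split=> /=.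
- move=> k; rewrite leq_eqVlt eqSS => /predU1P[<-|mk]; first by rewrite eqxx.
  by rewrite gtn_eqF// ca.
- by rewrite eqxx.
- move=> k mk; rewrite eqSS (gtn_eqF mk); have [->|km] := eqVneq k m.+1.
    move=> cE; apply/eqP; rewrite -leqn0 leqNgt; apply/negP => e0.
    have /cm : e%:R * D m.+1 - x <= D m.+1 - D m.+2 by rewrite e0 mul1r in ypos.
    by rewrite cE ltnn.
  by apply: cz; rewrite ltn_neqAle eq_sym km.
- move=> k kP; rewrite eqSS; have [km|km] := eqVneq k m; first by lia.
  by apply: c0; lia.
- rewrite eqxx (@eq_ostrowski_value _ c) => [|k mk]; last by rewrite eqSS gtn_eqF.
  rewrite addnS -addSn (_ : x - _ = - (e%:R * D m.+1 - x - ostrowski_value c m.+1 j)).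
    by rewrite normrN.
  by ring.
Qed.

(** For odd [m] the sign [(-1) ^+ m] reflects the range [[- D m.+1, D m]]. *)
Definition special_left m : R := if odd m then - D m else - D m.+1.

Lemma closure_ostrowski_from m : (1 <= m)%N ->
  closure [set to_circle (n%:R * alpha) | n in ostrowski_from alpha m]
  = circle_arc (special_left m) (D m.+1 + D m).
Proof.
move=> m1.
have D0 := cf_dist_gt0 alpha01 alpha_irr.
have a0 := cf_quot_gt0 alpha01 alpha_irr.
have signE x : special_left m <= x <= special_left m + (D m.+1 + D m) <->
    - D m.+1 <= (-1) ^+ m * x <= D m.
  by rewrite /special_left -signr_odd; case: (odd m); rewrite ?expr0 ?expr1; split; lra.
have circE c j : to_circle ((\sum_(m <= k < m + j) c k.+1 * q k)%N%:R * alpha)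
    = to_circle ((-1) ^+ m * ostrowski_value c m j).
  apply/eq_to_circle/intrP; rewrite -ostrowski_valueE.
  by exists (\sum_(m <= k < m + j) (c k.+1)%:Z * p k); ring.
have sq : (-1) ^+ m * (-1) ^+ m = 1 :> R by rewrite -exprD addnn -mul2n exprM sqrrN !expr1n.
have split_sum c j : (forall k, (k < m)%N -> c k.+1 = 0%N) ->
    (\sum_(0 <= k < m + j) c k.+1 * q k = \sum_(m <= k < m + j) c k.+1 * q k)%N.
  move=> cm; rewrite (@big_cat_nat _ _ _ m)//= ?leq_addr// big_nat big1// => k /andP[_ km].
  by rewrite cm.
apply/seteqP; split.
  rewrite [X in _ `<=` X](iffLR (closure_id _)); last first.
    by apply: closed_arc; rewrite addr_ge0 ?ltW.
  apply: closure_subset => _ [n [c [c1 ca cz [L cL ->]]] cm <-].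
  (* [L] may be smaller than [m], so the sum is padded with zero digits. *)
  have -> : (\sum_(0 <= k < L) c k.+1 * q k = \sum_(0 <= k < m + L) c k.+1 * q k)%N.
    rewrite [RHS](@big_cat_nat _ _ _ L)//= ?leq_addl//.
    rewrite [X in (_ + X)%N](_ : _ = 0)%N ?addn0//.
    by rewrite big_nat big1// => k /andP[Lk _]; rewrite cL.
  rewrite split_sum// circE; exists ((-1) ^+ m * ostrowski_value c m L) => //=.
  apply/signE; rewrite mulrA sq mul1r.
  by apply: ostrowski_value_bounds => k mk; apply: ca; lia.
move=> _ [x /= /signE xm <-] B /to_circle_continuous /nbhs_ballP[e /= e0 eB].
(* Both terms of the greedy error are made smaller than [e / 2]. *)
have [L DL] := cf_dist_small alpha01 alpha_irr (divr_gt0 e0 (ltr0Sn R 1)).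
have DL0 := DL _ (leq_addl m L); have DL1 := DL _ (leqW (leq_addl m L)).
have [c [ca cm cz c0 cx]] := ostrowski_greedy L xm.
exists (to_circle ((-1) ^+ m * ostrowski_value c m L)); split; last first.
  apply: eB; rewrite /ball/=; set v := ostrowski_value c m L in cx *.
  have -> : x - (-1) ^+ m * v = (-1) ^+ m * ((-1) ^+ m * x - v).
    by rewrite mulrBr mulrA sq mul1r.
  by rewrite normrM normrX normrN1 expr1n mul1r (le_lt_trans cx)//; lra.
rewrite -circE; eexists; last reflexivity.
exists c; last by move=> k km; apply: c0; rewrite km.
split.
- by rewrite c0 ?a0// m1.
- move=> k k1; case: (leqP m k) => mk; first exact: ca.
  by rewrite c0 ?mk.
- move=> k k1 ck; case: (ltnP m k) => mk; first exact: cz.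
  (* For [k <= m] the digit [c k] precedes the first free digit [c m.+1], hence vanishes. *)
  by case: k k1 ck mk => // k _ _ mk; rewrite c0// mk.
- exists (m + L)%N; last by rewrite split_sum// => k km; apply: c0; rewrite km.
  by move=> k kL; rewrite c0// kL orbT.
Qed.

Lemma special_intervalE m g : (1 <= m)%N ->
  special_interval alpha m (to_circle g)
  = circle_arc (g + special_left m) (D m.+1 + D m).
Proof. by move=> m1; rewrite -add_arc -closure_ostrowski_from. Qed.
End Ostrowski.

(** * Counting visits to an arc *)

Section Discrepancy.
Variables (R : realType) (alpha : R).
Hypotheses (alpha01 : 0 < alpha < 1) (alpha_irr : irrational alpha).

Local Notation q := (cf_denom alpha).
Local Notation p := (cf_num alpha).
Local Notation D := (cf_dist alpha).

Lemma cf_dist_le1 k : D k <= 1.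
Proof.
elim: k => [|k IH]; first by rewrite cf_dist0.
have := cf_dist_le alpha01 alpha_irr k.
have := cf_dist_gt0 alpha01 alpha_irr k.+2; lra.
Qed.

(** Modulo 1, translation by [D k.+1] is [q k] steps of the rotation, forwards or backwards by the
    parity of [k]. Each summand is thus an increment as in [sum_floor_increment], up to sign and the
    integer [p k]. *)
Lemma count_cf_dist k y N :
  `|(\sum_(0 <= n < N) (Num.floor (y + n%:R * alpha) -
                        Num.floor (y - D k.+1 + n%:R * alpha)))%:~R
    - N%:R * D k.+1| <= 3.
Proof.
have bound z := sum_floor_increment z N (cf_denom_gt0 alpha01 alpha_irr k)
  (cf_coprime alpha k) (cf_denom_approx alpha01 alpha_irr k).
have pkN : (p k *+ N)%:~R = N%:R * (p k)%:~R :> R by rewrite rmorphMn/= mulr_natl.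
have := cf_denom_dist alpha01 alpha_irr k; rewrite -signr_odd.
case: (odd k); rewrite ?expr0 ?expr1 ?mul1r ?mulN1r => dE.
  have -> : D k.+1 = (p k)%:~R - (q k)%:R * alpha by lra.
  have := bound y; rewrite -normrN; congr (`|_| <= _).
  rewrite [in RHS](eq_bigr (fun n => p k - (Num.floor (y + (n + q k)%:R * alpha) -
                        Num.floor (y + n%:R * alpha)))) => [|n _]; last first.
    rewrite (_ : y - _ + _ = y + (n + q k)%:R * alpha + (- p k)%:~R); last first.
      by rewrite natrD intrN; ring.
    by rewrite (floorDrz _ (intr_int _ _)) intrKfloor; ring.
  rewrite [in RHS]sumrB sumr_const_nat subn0 [in RHS]intrB pkN; ring.
have -> : D k.+1 = (q k)%:R * alpha - (p k)%:~R by lra.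
have := bound (y - (q k)%:R * alpha); congr (`|_| <= _).
rewrite [in RHS](eq_bigr (fun n => (Num.floor (y - (q k)%:R * alpha + (n + q k)%:R * alpha) -
                        Num.floor (y - (q k)%:R * alpha + n%:R * alpha)) - p k)) => [|n _]; last first.
  rewrite [X in _ - Num.floor X](_ : _ = y - (q k)%:R * alpha + n%:R * alpha + (p k)%:~R); last first.
    by ring.
  rewrite (floorDrz _ (intr_int _ _)) intrKfloor.
  rewrite (_ : _ + (n + q k)%:R * alpha = y + n%:R * alpha); first by ring.
  by rewrite natrD; ring.
rewrite [in RHS]sumrB sumr_const_nat subn0 [in RHS]intrB pkN; ring.
Qed.

End Discrepancy.

(** Two hits would make a nonzero integer multiple of [alpha] an integer. *)
Lemma count_int_translate_le1 (R : realType) (alpha v : R) N : irrational alpha ->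
  (\sum_(n < N) (n.+1%:R * alpha - v \is a Num.int)%R <= 1)%N.
Proof.
move=> alpha_irr.
rewrite -big_mkcond/= sum1_card; apply/card_le1_eqP => i j.
rewrite !unfold_in => /intrP[k kE] /intrP[l lE]; apply/ord_inj/eqP; apply: contraT => ij.
exfalso; apply: (alpha_irr : ~ rational alpha).
exists ((l - k)%:~R / ((j : nat)%:Z - (i : nat)%:Z)%:~R) => //.
rewrite fmorph_div/= !ratr_int !intrB -kE -lE -[i%:~R]/(i%:R) -[j%:~R]/(j%:R) -!natr1.
field; rewrite subr_eq0 eqr_nat; lia.
Qed.

Lemma card_ord_ge1 (N : nat) (P : pred nat) :
  #|[pred n : 'I_N.+1 | (1 <= n)%N && P n]| = (\sum_(n < N) P n.+1)%N.
Proof.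
rewrite -sum1_card big_mkcond big_ord_recl/= add0n; apply: eq_bigr => i _.
by rewrite inE/=; case: (P _).
Qed.

Unset Implicit Arguments.

Theorem theorem3p6 (R : realType) :
  exists2 K : R, 0 < K &
    forall alpha : R, 0 < alpha < 1 -> irrational alpha ->
    forall (m : nat) (gamma : circle R) (N : nat), (1 <= m)%N -> (1 <= N)%N ->
      `| #|[pred n : 'I_N.+1 | (1 <= n)%N &&
              (to_circle (n%:R * alpha) \in special_interval alpha m gamma)]|%:R
         - N%:R * circle_length (special_interval alpha m gamma) | <= K.
Proof.
(* 7 = 3 + 3 + 1: two subarcs, and one visit to the closed endpoint. *)
exists 7 => // alpha alpha01 alpha_irr m gamma N m1 _.
have [g ->] := to_circle_surj gamma; rewrite special_intervalE//.
set u := g + _; set s := cf_dist alpha m.+1 + _.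
have D0 := cf_dist_gt0 alpha01 alpha_irr.
have s01 : 0 <= s <= 1.
  rewrite addr_ge0 ?(ltW (D0 _))//= /s.
  have := cf_dist_le alpha01 alpha_irr m.-1; rewrite prednK//.
  have := cf_dist_le1 alpha01 alpha_irr m.-1; lra.
rewrite circle_length_arc//.
rewrite (card_ord_ge1 N (fun n => to_circle (n%:R * alpha) \in circle_arc u s)).
pose onend n := (n.+1%:R * alpha - (u + s)) \is a Num.int.
pose cnt y w := \sum_(0 <= n < N) (Num.floor (y + n%:R * alpha) -
                        Num.floor (y - w + n%:R * alpha)).
(* The extra [alpha] accounts for summing over [n] from 0 while visits are counted from time 1. *)
pose y := alpha - u.
have cntE : cnt y s = cnt y (cf_dist alpha m.+1)
    + cnt (y - cf_dist alpha m.+1) (cf_dist alpha m).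
  rewrite -big_split/=; apply: eq_bigr => n _.
  by rewrite addrA subrK -[y - _ - _]addrA -opprD.
have cnt1 := count_cf_dist alpha01 alpha_irr m y N.
(* The length [D m] belongs to the convergent of index [m.-1], available as [m >= 1]. *)
have cnt2 : `|(cnt (y - cf_dist alpha m.+1) (cf_dist alpha m))%:~R
    - N%:R * cf_dist alpha m| <= 3.
  by have := count_cf_dist alpha01 alpha_irr m.-1 (y - cf_dist alpha m.+1) N; rewrite prednK.
have cntI n : Num.floor (y + n%:R * alpha) - Num.floor (y - s + n%:R * alpha)
    = (n.+1%:R * alpha - u - (Num.floor (n.+1%:R * alpha - u))%:~R < s)%R%:Z.
  rewrite -floor_sub_indicator// /y -natr1.
  by congr (_ - _); congr Num.floor; ring.
have lo : (cnt y s <= (\sum_(n < N) (to_circle (n.+1%:R * alpha) \in circle_arc u s)%R)%N%:Z)%R.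
  rewrite /cnt big_mkord (big_morph _ PoszD (erefl 0%:Z)); apply: ler_sum => n _.
  rewrite cntI; case: ltP => // h; rewrite mem_set//; apply/circle_arcP; exact: ltW.
(* [cnt y s] counts visits to the half-open arc; a further visit to the closed one has fractional
   part exactly [s], so it is counted by [onend]. *)
have hi : ((\sum_(n < N) (to_circle (n.+1%:R * alpha) \in circle_arc u s)%R)%N%:Z
    <= cnt y s + (\sum_(n < N) onend n)%N%:Z)%R.
  rewrite /cnt big_mkord !(big_morph _ PoszD (erefl 0%:Z)) -big_split/=.
  apply: ler_sum => n _; rewrite cntI; case: ltP => h; first by case: (_ \in _) => //; lia.
  case: (boolP (_ \in _)) => // /set_mem /circle_arcP h'.
  rewrite /onend (_ : _ - (u + s) = (Num.floor (n.+1%:R * alpha - u))%:~R) ?intr_int//.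
  lra.
have one := count_int_translate_le1 (u + s) N alpha_irr.
move: lo hi; rewrite -/onend in one.
set c := (\sum_(n < N) _)%N; set e := (\sum_(n < N) onend n)%N => lo hi.
have {}one : (e <= 1)%N by [].
have : ((cnt y s)%:~R <= c%:R :> R) /\ (c%:R <= (cnt y s)%:~R + 1 :> R).
  rewrite -[c%:R]/((c%:Z)%:~R) -[1]/((1%:Z)%:~R) -intrD !ler_int; lia.
rewrite cntE intrD -/(cnt y _) in cnt1 *; rewrite /s.
by move: cnt1 cnt2; rewrite !ler_norml; lra.
Qed.
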